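(* There is a universal constant $\kappa>0$ such that the following holds. Let $n\ge 2$ and let $M$ and $N$ be two $n\times n$ complex hermitian matrices. Let $A\sim\rho_M$ and $B\sim\rho_N$ be independent random hermitian matrices, and let $H=A+B$. Then for every $x\in\mathbb{R}$, \[ \operatorname{Var}(F_H(x))\le \kappa\, \frac{\log n}{n}, \] and for every $t\ge 0$, \[ \mathbb{P}\{|F_H(x)-\mathbb{E}(F_H(x))|\ge t\}\le 2\exp\Bigl(-\frac{n t^2}{2\kappa\log n}\Bigr). \] The constant $\kappa$ does not depend on $n$, $M$, $N$, $x$ or $t$.
   Context: For an $n\times n$ hermitian matrix $M$: the empirical spectral measure $\mu_M$ is the probability measure on $\mathbb{R}$ putting mass $1/n$ on each eigenvalue of $M$ (counted with multiplicity); the empirical distribution function $F_M(x)=\mu_M((-\infty,x])$ is its cumulative distribution function. $\rho_M$ denotes the law of $UMU^*$ where $U$ is a random unitary matrix distributed according to the normalized Haar measure on the group $\mathcal{U}_n$ of $n\times n$ unitary matrices (i.e. the ''uniform distribution'' on hermitian matrices with the same spectrum as $M$). *)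

(* Defs.v *)
From HB Require Import structures.
From mathcomp Require Import all_boot all_order all_algebra.
From mathcomp Require Import all_classical all_reals all_analysis.
From mathcomp Require Import complex.

Set Implicit Arguments.
Unset Strict Implicit.
Unset Printing Implicit Defensive.

Import Order.TTheory GRing.Theory Num.Theory.
Local Open Scope classical_set_scope.
Local Open Scope ring_scope.

HB.instance Definition _ (R : realType) :=
  isPointed.Build R[i] (0 : R[i]).

Section defs.
Variable R : realType.

Definition adjmx (n : nat) (A : 'M[R[i]]_n) : 'M[R[i]]_n :=
  (A ^t* )%sesqui.

(* Empirical distribution function of a hermitian matrix:
   F_M(x) = (1/n) #{eigenvalues <= x, counted with multiplicity}.
   The eigenvalues (with multiplicity) are the roots of the characteristic
   polynomial, which splits over the algebraically closed field R[i]. *)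
Definition eigenvalues (n : nat) (A : 'M[R[i]]_n) : seq R[i] :=
  projT1 (closed_field_poly_normal (char_poly A)).

Definition edf (n : nat) (A : 'M[R[i]]_n) (x : R) : R :=
  (count (fun z : R[i] => z <= (x%:C)%C) (eigenvalues A))%:R / n%:R.

(* Borel sigma-algebra on n x n complex matrices: generated by the real and
   imaginary parts of the entries (identifying 'M[R[i]]_n with R^(2n^2)). *)
Definition mat_gen (n : nat) : set (set 'M[R[i]]_n) :=
  [set S | exists (i j : 'I_n) (B : set R), measurable B /\
     (S = (fun A : 'M[R[i]]_n => complex.Re (A i j)) @^-1` B \/
      S = (fun A : 'M[R[i]]_n => complex.Im (A i j)) @^-1` B)].

Definition matT (n : nat) := g_sigma_algebraType (@mat_gen n).
HB.instance Definition _ (n : nat) :=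
  Measurable.copy (matT n) (g_sigma_algebraType (@mat_gen n)).

(* mu is the normalized Haar measure on the unitary group U_n (seen as a
   probability measure on n x n complex matrices concentrated on U_n):
   it is the unique such measure invariant under left translations. *)
Definition haar (n : nat) (mu : probability (matT n) R) : Prop :=
  mu [set U : matT n | (U : 'M[R[i]]_n) \is unitarymx] = 1%E /\
  forall W : 'M[R[i]]_n, W \is unitarymx ->
    forall S : set (matT n), measurable S ->
      mu ((fun U : matT n => (W *m U : matT n)) @^-1` S) = mu S.

End defs.

(* Main.v *)
(* With [U], [V] Haar distributed, a matrix of rank at most 1 added to [U] or [V]
   perturbs [H] by a matrix of rank at most 2, hence changes each eigenvalue
   count, and so [n * F_H(x)], by at most 2. It therefore suffices to have a
   bounded difference inequality on the unitary group along the chain of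
   subgroups [G_k] fixing the first [k] basis vectors: averaging a function over
   [G_(k+1)] acting on the right leaves a function of [U e_k] on [G_k], and any
   two unit vectors are exchanged by a unitary [W] with [W - 1] of rank 1, so this
   average oscillates by no more than the bounded difference. Multiplying the
   [n] resulting Hoeffding bounds makes [F_H(x)] subgaussian with variance proxy
   [O(1/n)], which is even stronger than [O(log n / n)].
   The Haar measure of [G_(k+1)] is the law of [U W], where [U] is Haar on [G_k]
   and [W] is the above unitary mapping [e_k] to [U^* e_k]. *)
Require Import Defs.
From HB Require Import structures.
From mathcomp Require Import all_boot all_order all_algebra.
From mathcomp Require Import all_classical all_reals all_analysis.
From mathcomp Require Import complex measurable_realfun zify ring lra.

Import Order.TTheory GRing.Theory Num.Theory.
Import numFieldNormedType.Exports.
Local Open Scope classical_set_scope.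
Local Open Scope ring_scope.

Set Implicit Arguments.
Unset Strict Implicit.
Unset Printing Implicit Defensive.

(** * Eigenvalue counts and low rank perturbations *)

Lemma char_poly_similar (F : fieldType) n (P D : 'M[F]_n) :
  P \in unitmx -> char_poly (invmx P *m D *m P) = char_poly D.
Proof.
move=> Pu; rewrite /char_poly.
have -> : char_poly_mx (invmx P *m D *m P) =
    map_mx polyC (invmx P) *m char_poly_mx D *m map_mx polyC P.
  rewrite /char_poly_mx !map_mxM mulmxBr mulmxBl; congr (_ - _).
  rewrite -mulmxA -scalar_mxC mulmxA -map_mxM mulVmx // map_mx1 mul1mx //.
rewrite !det_mulmx mulrAC -det_mulmx -map_mxM mulVmx // map_mx1 det1 mul1r //.
Qed.

Section Spectral.
Variable C : numClosedFieldType.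
Local Open Scope sesquilinear_scope.

Lemma rowsub_unitarymx m n p (f : 'I_m -> 'I_n) (P : 'M[C]_(n, p)) :
  injective f -> P \is unitarymx -> rowsub f P \is unitarymx.
Proof.
move=> f_inj /unitarymxP PP; apply/unitarymxP/matrixP => i j.
have /matrixP/(_ (f i) (f j)) := PP; rewrite !mxE (inj_eq f_inj) => <-.
by apply: eq_bigr => k _; rewrite !mxE.
Qed.

(** On the span of the eigenvectors selected by [f], the quadratic form of [A] is a weighted sum of
    the selected eigenvalues. A bound on these eigenvalues thus bounds the form on the whole
    span. *)
Lemma spectral_form m n (A : 'M[C]_n) (f : 'I_m -> 'I_n) (u : 'rV[C]_m) :
    injective f -> A \is normalmx ->
    let v := u *m rowsub f (spectralmx A) in
  (v *m A *m v^t*) 0 0 = \sum_k spectral_diag A 0 (f k) * `|u 0 k| ^+ 2 /\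
  (v *m v^t*) 0 0 = \sum_k `|u 0 k| ^+ 2.
Proof.
move=> f_inj /orthomx_spectralP A_eq /=.
set P := spectralmx A in A_eq *; set d := spectral_diag A in A_eq *.
have PU : P \is unitarymx := spectral_unitarymx A.
have XU := rowsub_unitarymx f_inj PU.
set X := rowsub f P in XU *.
rewrite !trmx_mul !map_mxM; split; last first.
  rewrite mulmxA mulmxtVK // mxE; apply: eq_bigr => k _.
  by rewrite !mxE -normCK.
have XP : X *m invmx P = rowsub f 1%:M.
  by rewrite /X mul_rowsub_mx mulmxV ?unitarymx_unit.
rewrite {1}A_eq.
have -> : u *m X *m (invmx P *m diag_mx d *m P) *m (X^t* *m u^t*) =
   u *m ((X *m invmx P) *m diag_mx d *m (P *m X^t*)) *m u^t*.
  by rewrite !mulmxA.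
rewrite XP.
have -> : P *m X^t* = colsub f 1%:M.
  by rewrite trmx_mxsub map_mxsub mulmx_colsub (unitarymxP PU).
rewrite mul_rowsub_mx mul1mx mulmx_colsub mulmx1 -mxsub_comp mxE.
apply: eq_bigr => k _; rewrite !mxE (bigD1 k) //= !mxE eqxx mulr1n big1 ?addr0.
  by rewrite mulrAC -normCK mulrC.
by move=> j jk; rewrite !mxE (inj_eq f_inj) (negbTE jk) mulr0n mulr0.
Qed.

(** Weyl's argument: if the bound failed, a nonzero vector would lie in the span of the eigenvectors
    of [A] with eigenvalue at most [c], in the span of those of [B] with eigenvalue above [c], and
    in the kernel of [A - B]. The two quadratic forms agree at this vector, yet [c] times its
    squared norm would separate them strictly. *)
Lemma rank_spectral_count n (A B : 'M[C]_n) (c : C) :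
    A \is hermsymmx -> B \is hermsymmx -> c \is Num.real ->
  (#|[set i | (spectral_diag A 0 i <= c)%R]%SET| <=
   #|[set i | (spectral_diag B 0 i <= c)%R]%SET| + \rank (A - B)%R)%N.
Proof.
move=> hA hB cR.
set S := finset _; set T' := finset _; set T := (~: T')%SET.
set X := rowsub (enum_val : 'I_#|S| -> 'I_n) (spectralmx A).
set Y := rowsub (enum_val : 'I_#|T| -> 'I_n) (spectralmx B).
set K := kermx (A - B).
have rX : \rank X = #|S|.
  exact/mxrank_unitary/rowsub_unitarymx/spectral_unitarymx/enum_val_inj.
have rY : \rank Y = #|T|.
  exact/mxrank_unitary/rowsub_unitarymx/spectral_unitarymx/enum_val_inj.
have rK : \rank K = (n - \rank (A - B)%R)%N by rewrite mxrank_ker.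
have cT : (#|T'| + #|T| = n)%N by rewrite cardsC card_ord.
rewrite leqNgt; apply/negP => lt.
(* By [lt] the three dimensions [#|S|], [n - #|T'|] and [n - \rank (A - B)] sum to more than
   [2n]. *)
have XYK : (X :&: Y :&: K)%MS != 0.
  rewrite -mxrank_eq0 -lt0n.
  have := mxrank_sum_cap X Y; have := mxrank_sum_cap (X :&: Y)%MS K.
  have := rank_leq_col (X + Y)%MS; have := rank_leq_col (X :&: Y + K)%MS.
  have := rank_leq_col (A - B).
  rewrite rX rY rK; lia.
case/rowV0Pn: XYK => v; rewrite !sub_capmx.
move=> /andP[/andP[/submxP[u vu] /submxP[w vw]] /sub_kermxP vK] v0.
have AB : v *m A = v *m B by apply/eqP; rewrite -subr_eq0 -mulmxBr vK.
have [a1 a2] := spectral_form u (@enum_val_inj _ _) (hermitian_normalmx hA).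
have [b1 b2] := spectral_form w (@enum_val_inj _ _) (hermitian_normalmx hB).
rewrite -/X -vu in a1 a2; rewrite -/Y -vw in b1 b2.
have h1 : (v *m A *m v^t*) 0 0 <= c * (v *m v^t*) 0 0.
  rewrite a1 a2 mulr_sumr; apply: ler_sum => k _.
  apply: ler_wpM2r; first exact: exprn_ge0.
  by have := enum_valP k; rewrite inE.
have h2 : c * (v *m v^t*) 0 0 < (v *m A *m v^t*) 0 0.
  rewrite AB b1 b2 mulr_sumr.
  have [j wj] : exists j, w 0 j != 0.
    by apply/rV0Pn; apply: contraNneq v0 => w0; rewrite vw w0 mul0mx.
  have dc (k : 'I_#|T|) : c < spectral_diag B 0 (enum_val k).
    have := enum_valP k.
    rewrite finset.in_setC inE -real_ltNge //.
    exact/mxOverP/hermitian_spectral_diag_real.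
  rewrite (bigD1 j) //= [ltRHS](bigD1 j) //=; apply: ltr_leD.
    by rewrite ltr_pM2r // exprn_gt0 // normr_gt0.
  by apply: ler_sum => k _; rewrite ler_wpM2r ?exprn_ge0 // ltW.
by have := le_lt_trans h1 h2; rewrite ltxx.
Qed.
End Spectral.

Section Edf.
Variable R : realType.
Variable n : nat.
Implicit Types (A B M K U V : 'M[R[i]]_n) (x : R).

(** Both lists of eigenvalues factor the characteristic polynomial into monic linear factors, so
    they agree up to order, and a count does not see the order. *)
Lemma edf_spectral A x : A \is hermsymmx ->
  edf A x = #|[set i | (spectral_diag A 0 i <= x%:C%C)%R]%SET|%:R / n%:R.
Proof.
move=> hA; rewrite /edf; congr (_%:R / _).
have /orthomx_spectralP A_eq := hermitian_normalmx hA.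
set d := spectral_diag A in A_eq *.
have e : perm_eq (eigenvalues A) [seq d 0 i | i : 'I_n].
  apply: prod_XsubC_eq; rewrite /eigenvalues.
  case: closed_field_poly_normal => r /= r_eq.
  have := r_eq; rewrite (monicP (char_poly_monic A)) scale1r => <-.
  rewrite A_eq char_poly_similar ?spectral_unit //.
  rewrite char_poly_trig ?diag_mx_is_trig // big_image /=.
  by apply: eq_bigr => i _; rewrite mxE eqxx mulr1n.
by rewrite (permP e) -sum1_count big_image_cond -sum1_card; apply: eq_bigl => i; rewrite !inE.
Qed.

Lemma edf_ge0 A x : 0 <= edf A x.
Proof. by rewrite divr_ge0. Qed.

Lemma edf_le1 A x : A \is hermsymmx -> edf A x <= 1.
Proof.
move=> hA; rewrite edf_spectral //.
(* For [n = 0] the quotient is 0, because the inverse of 0 is 0. *)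
have [n0|n0] := posnP n.
  by rewrite [X in _ / X%:R]n0 invr0 mulr0.
by rewrite ler_pdivrMr ?ltr0n // mul1r ler_nat -[leqRHS]card_ord max_card.
Qed.

Lemma edf_rank A B x r : A \is hermsymmx -> B \is hermsymmx ->
  (\rank (A - B)%R <= r)%N -> `|edf A x - edf B x| <= r%:R / n%:R.
Proof.
move=> hA hB rAB; rewrite !edf_spectral //.
have xR : x%:C%C \is Num.real by apply/complex_realP; exists x.
have h1 := rank_spectral_count hA hB xR.
have h2 := rank_spectral_count hB hA xR.
rewrite -mulrBl normrM [X in _ * X]ger0_norm ?invr_ge0 //.
rewrite ler_wpM2r ?invr_ge0 //.
rewrite -opprB mxrank_opp in h2.
rewrite ler_distl lerBlDr -!natrD !ler_nat.
by rewrite (leq_trans h1) ?(leq_trans h2) ?leq_add2l.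
Qed.

Lemma herm_conj M U : M \is hermsymmx -> U *m M *m adjmx U \is hermsymmx.
Proof.
move=> /is_hermitianmxP; rewrite expr0 scale1r => hM.
apply/is_hermitianmxP; rewrite expr0 scale1r /adjmx !trmx_mul !map_mxM /= trmxCK.
by rewrite -hM mulmxA.
Qed.

Lemma hermD A B : A \is hermsymmx -> B \is hermsymmx -> A + B \is hermsymmx.
Proof.
move=> /is_hermitianmxP; rewrite expr0 scale1r => hA.
move=> /is_hermitianmxP; rewrite expr0 scale1r => hB.
apply/is_hermitianmxP; rewrite expr0 scale1r [(_ + _)^T]raddfD map_mxD /=.
by rewrite -hA -hB.
Qed.

(** The difference telescopes through $V M U^*$ into two products, each with a factor of rank at
    most 1. *)
Lemma rank_conj_sub M U V : (\rank (U - V)%R <= 1)%N ->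
  (\rank (U *m M *m adjmx U - V *m M *m adjmx V)%R <= 2)%N.
Proof.
move=> rUV.
have -> : U *m M *m adjmx U - V *m M *m adjmx V =
    (U - V) *m (M *m adjmx U) + V *m M *m adjmx (U - V).
  by rewrite /adjmx raddfB map_mxB /= mulmxBr mulmxBl !mulmxA addrA subrK.
have rUV' : (\rank (adjmx (U - V)%R) <= 1)%N by rewrite mxrank_map mxrank_tr.
apply: leq_trans (mxrank_add _ _) _.
rewrite (@leq_add _ _ 1 1) //.
  exact: leq_trans (mxrankM_maxl _ _) rUV.
exact: leq_trans (mxrankM_maxr _ _) rUV'.
Qed.

End Edf.

(** * Reflections and the chain of stabilizers *)

Section Reflection.
Variable C : numClosedFieldType.
Variable n : nat.
Local Open Scope sesquilinear_scope.
Implicit Types (u v w : 'cV[C]_n) (U V : 'M[C]_n).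

(** The hermitian inner product, antilinear in the first argument. *)
Definition cdot v w : C := (v^t* *m w) 0 0.

Lemma cdotE v w : v^t* *m w = (cdot v w)%:M.
Proof. by rewrite [LHS]mx11_scalar. Qed.

Lemma cdotBl u v w : cdot (u - v) w = cdot u w - cdot v w.
Proof. by rewrite /cdot raddfB map_mxB /= mulmxBl !mxE. Qed.

Lemma cdotBr u v w : cdot u (v - w) = cdot u v - cdot u w.
Proof. by rewrite /cdot mulmxBr !mxE. Qed.

Lemma cdotC v w : (cdot v w)^* = cdot w v.
Proof.
rewrite /cdot !mxE rmorph_sum; apply: eq_bigr => i _.
by rewrite !mxE rmorphM /= conjCK mulrC.
Qed.

Lemma cdot_adj U v w : cdot v (U *m w) = cdot (U^t* *m v) w.
Proof. by rewrite /cdot trmx_mul map_mxM /= trmxCK !mulmxA. Qed.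

Lemma cdot_delta (i j : 'I_n) :
  cdot (delta_mx i 0) (delta_mx j 0) = (i == j)%:R.
Proof.
rewrite /cdot mxE (bigD1 i) //= !mxE !eqxx !andbT rmorph1 mul1r big1 ?addr0 //.
by move=> k ki; rewrite !mxE (negbTE ki) rmorph0 mul0r.
Qed.

Lemma cdot_eq0 v : cdot v v = 0 -> v = 0.
Proof.
rewrite /cdot mxE => /psumr_eq0P h; apply/colP => i; rewrite mxE.
have /eqP : (v^t*) 0 i * v i 0 = 0.
  by apply: h => // j _; rewrite !mxE mulrC mul_conjC_ge0.
by rewrite !mxE mulrC mul_conjC_eq0 => /eqP.
Qed.

Lemma unitary_adjmul U : U \is unitarymx -> U^t* *m U = 1%:M.
Proof. by rewrite -trmxC_unitary => /unitarymxP; rewrite trmxCK. Qed.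

Lemma cdot_unitary U v w : U \is unitarymx -> cdot (U *m v) (U *m w) = cdot v w.
Proof. by move=> hU; rewrite cdot_adj mulmxA unitary_adjmul // mul1mx. Qed.

(* The unitary with [refl v w *m v = w] for unit vectors [v], [w] that is the
   identity on the complement of [v - w]; it is [1%:M] when [v = w], because
   then [v - w = 0] (and the inverse is the junk value [0]). *)
Definition refl v w : 'M[C]_n :=
  1%:M - (1 - cdot w v)^-1 *: ((v - w) *m (v - w)^t*).

Lemma rank_refl v w : (\rank (refl v w - 1%:M)%R <= 1)%N.
Proof.
rewrite /refl addrC addKr mxrank_opp scalemxAl.
exact: leq_trans (mxrankM_maxl _ _) (rank_leq_col _).
Qed.

Lemma refl_fix v w u : cdot v u = cdot w u -> refl v w *m u = u.
Proof.
move=> e; rewrite /refl mulmxBl mul1mx -scalemxAl -mulmxA cdotE cdotBl e subrr.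
by rewrite mul_mx_scalar scale0r scaler0 subr0.
Qed.

Lemma refl_swap v w : cdot v v = 1 -> cdot w w = 1 -> refl v w *m v = w.
Proof.
move=> v1 w1; rewrite /refl mulmxBl mul1mx -scalemxAl -mulmxA cdotE cdotBl v1.
(* The scalar $1 - \langle w, v\rangle$ cancels against its inverse in [refl] unless it vanishes;
   for unit vectors it vanishes only if [v = w]. *)
rewrite mul_mx_scalar scalerA; have [a0|a0] := eqVneq (1 - cdot w v) 0; last first.
  by rewrite mulVf // scale1r opprB addrC subrK.
have vw : v - w = 0.
  have b0 : 1 - cdot v w = 0 by rewrite -cdotC -(rmorph1 Num.conj) -rmorphB a0 rmorph0.
  by apply: cdot_eq0; rewrite cdotBl !cdotBr v1 w1 b0 -[_ - 1]opprB a0 oppr0 subrr.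
by rewrite vw scaler0 subr0; apply/eqP; rewrite -subr_eq0 vw.
Qed.

Lemma refl_unitary v w : cdot v v = 1 -> cdot w w = 1 ->
  refl v w \is unitarymx.
Proof.
move=> v1 w1; apply/unitarymxP; rewrite /refl.
set a := 1 - cdot w v; set d := v - w.
have dd : cdot d d = a + a^*.
  rewrite /d /a cdotBl !cdotBr v1 w1 rmorphB rmorph1 /= cdotC; ring.
have -> : (1%:M - a^-1 *: (d *m d^t*))^t* = 1%:M - (a^*)^-1 *: (d *m d^t*).
  rewrite raddfB map_mxB /= trmx1 map_mx1 linearZ /= map_mxZ fmorphV.
  by rewrite trmx_mul map_mxM /= trmxCK.
rewrite mulmxBl mul1mx mulmxBr mulmx1 -scalemxAl -scalemxAr.
rewrite -mulmxA (mulmxA (d^t*)) cdotE dd mul_scalar_mx -scalemxAr !scalerA.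
set X := d *m _.
rewrite -addrA -opprD -scalerBl -scalerDl.
(* This is the coefficient of $d d^*$ in the product of [refl v w] with its adjoint; it vanishes
   because $|d|^2 = a + \bar a$. For [a = 0] all inverses are 0. *)
have -> : a^*^-1 + (a^-1 - a^-1 * (a^*^-1 * (a + a^*))) = 0.
  have [->|a0] := eqVneq a 0; first by rewrite rmorph0 invr0 !mul0r subr0 addr0.
  by field; rewrite a0 conjC_eq0 a0.
by rewrite scale0r subr0.
Qed.

(** The subgroup $G_k$ of the chain, which descends from the full unitary group at [k = 0] to the
    identity at [k = n]. *)
Definition stab k U := U \is unitarymx /\
  forall j : 'I_n, (j < k)%N -> U *m delta_mx j 0 = delta_mx j 0 :> 'cV_n.

Lemma stabM k U V : stab k U -> stab k V -> stab k (U *m V).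
Proof.
move=> [hU fU] [hV fV]; split; first exact: mul_unitarymx.
by move=> j jk; rewrite -mulmxA fV // fU.
Qed.

Lemma stab_adj k U : stab k U -> stab k (U^t*).
Proof.
move=> [hU fU]; split; first by rewrite trmxC_unitary.
by move=> j jk; rewrite -{1}(fU j jk) mulmxA unitary_adjmul // mul1mx.
Qed.

Lemma stabS k U : stab k.+1 U -> stab k U.
Proof. by move=> [hU fU]; split=> // j jk; apply: fU; apply: ltnW. Qed.

Lemma stab_succ (k : 'I_n) U : stab k U ->
  U *m delta_mx k 0 = delta_mx k 0 :> 'cV_n -> stab k.+1 U.
Proof.
move=> [hU fU] Uk; split=> // j; rewrite ltnS leq_eqVlt => /orP[/eqP jk|]; last exact: fU.
by have -> : j = k by apply/val_inj.
Qed.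

Lemma stab_full U : stab n U -> U = 1%:M.
Proof.
move=> [_ fU]; apply/matrixP => i j.
by have /colP/(_ i) := fU j (ltn_ord j); rewrite -colE !mxE eqxx andbT.
Qed.

Lemma refl_stab (k : 'I_n) v w : cdot v v = 1 -> cdot w w = 1 ->
    (forall j : 'I_n, (j < k)%N -> cdot v (delta_mx j 0) = 0) ->
    (forall j : 'I_n, (j < k)%N -> cdot w (delta_mx j 0) = 0) ->
  stab k (refl v w).
Proof.
move=> v1 w1 vk wk; split; first exact: refl_unitary.
by move=> j jk; apply: refl_fix; rewrite vk // wk.
Qed.

(** Supplies the hypotheses of [refl_stab] for the images of $e_k$ under $G_k$: unitaries preserve
    orthogonality to the fixed basis vectors. *)
Lemma stab_cdot (k : 'I_n) U : stab k U ->
  cdot (U *m delta_mx k 0) (U *m delta_mx k 0) = 1 /\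
  forall j : 'I_n, (j < k)%N -> cdot (U *m delta_mx k 0) (delta_mx j 0) = 0.
Proof.
move=> [hU fU]; split; first by rewrite cdot_unitary // cdot_delta eqxx.
move=> j jk; rewrite -(fU j jk) cdot_unitary // cdot_delta.
by rewrite -val_eqE /= gtn_eqF.
Qed.

(** A retraction of $G_k$ onto $G_{k+1}$: the right factor sends $e_k$ to $U^* e_k$, which [U] sends
    back to $e_k$. *)
Definition stab_proj (k : 'I_n) U : 'M[C]_n :=
  U *m refl (delta_mx k 0) (U^t* *m delta_mx k 0).

Lemma stab_projP (k : 'I_n) U : stab k U -> stab k.+1 (stab_proj k U).
Proof.
move=> sU; have [hU fU] := sU.
have [w1 wk] := stab_cdot (stab_adj sU).
have e1 : cdot (delta_mx k 0 : 'cV_n) (delta_mx k 0) = 1 by rewrite cdot_delta eqxx.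
apply: stab_succ; last first.
  rewrite /stab_proj -mulmxA refl_swap // mulmxA.
  by rewrite (unitarymxP hU) mul1mx.
apply: stabM => //; apply: refl_stab => // j jk.
by rewrite cdot_delta -val_eqE /= gtn_eqF.
Qed.

(** Since $U^*$ fixes $e_k$, the reflection for [U *m V] is the one for [V]. This equivariance
    carries left invariance over to the image measure. *)
Lemma stab_projM (k : 'I_n) U V : stab k.+1 U ->
  stab_proj k (U *m V) = U *m stab_proj k V.
Proof.
move=> /stab_adj[_ fU]; rewrite /stab_proj trmx_mul map_mxM /= -!mulmxA.
by rewrite fU.
Qed.

(** The reflection [W] taking $U e_k$ to $V e_k$ puts [W *m U] in the coset $V G_{k+1}$, at the
    price of a perturbation of rank at most 1. *)
Lemma stab_link (k : 'I_n) U V : stab k U -> stab k V ->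
  exists2 W, (\rank (W - 1%:M)%R <= 1)%N & stab k.+1 (V^t* *m (W *m U)).
Proof.
move=> sU sV; exists (refl (U *m delta_mx k 0) (V *m delta_mx k 0)).
  exact: rank_refl.
have [v1 vk] := stab_cdot sU; have [w1 wk] := stab_cdot sV.
apply: stab_succ.
  apply: stabM; first exact: stab_adj.
  by apply: stabM => //; exact: refl_stab.
by rewrite -!mulmxA refl_swap // mulmxA unitary_adjmul ?mul1mx //; case: sV.
Qed.

End Reflection.

(** * Entrywise measurability *)

Section Measurability.
Context (R : realType) d (T : measurableType d).
Local Notation Re := complex.Re.
Local Notation Im := complex.Im.

(** Real and imaginary parts are what generates the $\sigma$-algebra of [matT], see [mmeasP]. *)
Definition cmeas (f : T -> R[i]) :=
  measurable_fun setT (fun t => Re (f t)) /\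
  measurable_fun setT (fun t => Im (f t)).

Lemma cmeas_cst c : cmeas (fun=> c).
Proof. by split; exact: measurable_cst. Qed.

Lemma cmeasD f g : cmeas f -> cmeas g -> cmeas (fun t => f t + g t).
Proof.
move=> [f1 f2] [g1 g2]; split.
  under eq_fun do rewrite raddfD; exact: measurable_funD.
under eq_fun do rewrite raddfD; exact: measurable_funD.
Qed.

Lemma cmeasN f : cmeas f -> cmeas (fun t => - f t).
Proof.
move=> [f1 f2]; split; under eq_fun do rewrite raddfN; exact: measurable_funN.
Qed.

Lemma cmeasM f g : cmeas f -> cmeas g -> cmeas (fun t => f t * g t).
Proof.
have eR (x y : R[i]) : Re (x * y) = Re x * Re y - Im x * Im y by case: x y => [a b] [c e].
have eI (x y : R[i]) : Im (x * y) = Re x * Im y + Im x * Re y by case: x y => [a b] [c e].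
move=> [f1 f2] [g1 g2]; split.
  under eq_fun do rewrite eR.
  by apply: measurable_funB; apply: measurable_funM.
under eq_fun do rewrite eI.
by apply: measurable_funD; apply: measurable_funM.
Qed.

Lemma cmeas_conj f : cmeas f -> cmeas (fun t => (f t)^*%R).
Proof.
have eR (x : R[i]) : Re (x^*%R) = Re x by case: x.
have eI (x : R[i]) : Im (x^*%R) = - Im x by case: x.
move=> [f1 f2]; split; first by under eq_fun do rewrite eR.
under eq_fun do rewrite eI; exact: measurable_funN.
Qed.

Lemma cmeasV f : cmeas f -> cmeas (fun t => (f t)^-1).
Proof.
move=> [f1 f2].
have eR (x : R[i]) : Re x^-1 = Re x * (Re x ^+ 2 + Im x ^+ 2)^-1 by case: x.
have eI (x : R[i]) : Im x^-1 = - (Im x * (Re x ^+ 2 + Im x ^+ 2)^-1) by case: x.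
have mN : measurable_fun setT (fun t => (Re (f t) ^+ 2 + Im (f t) ^+ 2)^-1).
  (* The power with exponent [-1] is measurable and equals the inverse on all nonnegative reals, 0
     included. *)
  have -> : (fun t => (Re (f t) ^+ 2 + Im (f t) ^+ 2)^-1) =
      (@powR R ^~ (-1)) \o (fun t => Re (f t) ^+ 2 + Im (f t) ^+ 2).
    by apply/funext => t /=; rewrite powR_inv1 // addr_ge0 ?sqr_ge0.
  apply: measurableT_comp; first exact: measurable_powR.
  by apply: measurable_funD; apply: measurable_funX.
split.
  under eq_fun do rewrite eR; exact: measurable_funM.
under eq_fun do rewrite eI; apply: measurable_funN; exact: measurable_funM.
Qed.

Lemma cmeas_sum (I : finType) (f : I -> T -> R[i]) :
  (forall i, cmeas (f i)) -> cmeas (fun t => \sum_i f i t).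
Proof.
move=> mf; elim: (index_enum I) => [|i s IH].
  by under eq_fun do rewrite big_nil; exact: cmeas_cst.
by under eq_fun do rewrite big_cons; exact: cmeasD.
Qed.

Definition mmeas m n (F : T -> 'M[R[i]]_(m, n)) :=
  forall i j, cmeas (fun t => F t i j).

Lemma mmeas_cst m n (A : 'M[R[i]]_(m, n)) : mmeas (fun=> A).
Proof. by move=> i j; exact: cmeas_cst. Qed.

Lemma mmeasD m n (F G : T -> 'M[R[i]]_(m, n)) :
  mmeas F -> mmeas G -> mmeas (fun t => F t + G t).
Proof. by move=> mF mG i j; under eq_fun do rewrite mxE; exact: cmeasD. Qed.

Lemma mmeasN m n (F : T -> 'M[R[i]]_(m, n)) :
  mmeas F -> mmeas (fun t => - F t).
Proof. by move=> mF i j; under eq_fun do rewrite mxE; exact: cmeasN. Qed.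

Lemma mmeasZ m n (f : T -> R[i]) (F : T -> 'M[R[i]]_(m, n)) :
  cmeas f -> mmeas F -> mmeas (fun t => f t *: F t).
Proof. by move=> mf mF i j; under eq_fun do rewrite mxE; exact: cmeasM. Qed.

Lemma mmeasM m n p (F : T -> 'M[R[i]]_(m, n)) (G : T -> 'M[R[i]]_(n, p)) :
  mmeas F -> mmeas G -> mmeas (fun t => F t *m G t).
Proof.
move=> mF mG i j; under eq_fun do rewrite mxE.
by apply: cmeas_sum => k; exact: cmeasM.
Qed.

Lemma mmeas_adj m n (F : T -> 'M[R[i]]_(m, n)) :
  mmeas F -> mmeas (fun t => (F t ^t*)%sesqui).
Proof.
by move=> mF i j; under eq_fun do rewrite !mxE; exact: cmeas_conj.
Qed.

Lemma mmeasP n (F : T -> matT R n) :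
  mmeas (F : T -> 'M[R[i]]_n) <-> measurable_fun setT F.
Proof.
split=> mF; last first.
  move=> i j; split.
    apply: (measurableT_comp (f := fun A : matT R n => Re (A i j))) mF.
    move=> _ B mB; rewrite setTI; apply: sub_sigma_algebra.
    by exists i, j, B; split => //; left.
  apply: (measurableT_comp (f := fun A : matT R n => Im (A i j))) mF.
  move=> _ B mB; rewrite setTI; apply: sub_sigma_algebra.
  by exists i, j, B; split => //; right.
refine (@measurability _ _ T (matT R n) setT F (@mat_gen R n) _ _) => //.
move=> _ [_ [i [j [B [mB [->|->]]]]] <-].
  exact: (mF i j).1.
exact: (mF i j).2.
Qed.

End Measurability.

(** * Measurability of the empirical distribution function *)

(* Iterating [s + s ^+ 2 - s ^+ 3] pushes ]0, 1] to 1 and [-1/2, 0] to 0. *)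
Definition step_poly (F : fieldType) (s : F) := s + s ^+ 2 - s ^+ 3.

Section Step.
Variable R : realType.

(** The increment $s^2(1 - s)$ is nonnegative below 1, so the iterates increase to a fixed point,
    which is 0 or 1. A positive start excludes 0; a start in $[-1/2, 0]$ keeps the iterates
    nonpositive and excludes 1. *)
Lemma step_poly_cvg (s : R) : - 2^-1 <= s <= 1 ->
  iter m (@step_poly R) s @[m --> \oo] --> ((0 < s)%R%:R : R).
Proof.
move=> /andP[sl su]; pose u m := iter m (@step_poly R) s.
have inc (y : R) : y <= 1 -> y <= step_poly y.
  move=> y1; rewrite -subr_ge0.
  have -> : step_poly y - y = y ^+ 2 * (1 - y) by rewrite /step_poly; ring.
  by rewrite mulr_ge0 ?sqr_ge0 // subr_ge0.
have ub m : - 2^-1 <= u m <= 1.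
  elim: m => [|m /andP[h1 h2]]; first by apply/andP; split.
  rewrite /u iterS -/(u m) (le_trans h1 (inc _ h2)) /= -subr_ge0.
  have -> : 1 - step_poly (u m) = (1 - u m) ^+ 2 * (1 + u m).
    rewrite /step_poly; ring.
  by rewrite mulr_ge0 ?sqr_ge0 //; lra.
have u1 m : u m <= 1 by case/andP: (ub m).
have und : {homo u : a b / (a <= b)%N >-> a <= b}.
  by apply/nondecreasing_seqP => m; rewrite /u iterS; exact: inc (u1 m).
have uc : cvgn u.
  by apply: nondecreasing_is_cvgn => //; exists 1 => _ [m _ <-].
set l := limn u.
have ul : u m @[m --> \oo] --> l by [].
have gl : step_poly l = l.
  have h1 : u m.+1 @[m --> \oo] --> l by rewrite cvg_shiftS.
  have h2 : step_poly (u m) @[m --> \oo] --> step_poly l.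
    by apply: cvgB; [apply: cvgD => //; exact: cvgM | apply: cvgM => //; exact: cvgM].
  exact: (cvg_unique _ h2 h1).
have sl' : s <= l by apply: (nondecreasing_cvgn_le und uc 0).
have lE : l = 0 \/ l = 1.
  have : l ^+ 2 * (1 - l) = 0 by move: gl; rewrite /step_poly; lra.
  move/eqP; rewrite mulf_eq0 sqrf_eq0 subr_eq0 => /orP[/eqP|/eqP]; by [left|right].
suff -> : (0 < s)%R%:R = l :> R by [].
case: ltP => s0; first by case: lE => l0 //; lra.
have un m : - 2^-1 <= u m <= 0.
  elim: m => [|m /andP[h1 h2]]; first by apply/andP; split.
  rewrite /u iterS -/(u m) (le_trans h1 (inc _ (u1 m))) /=.
  (* The second factor is positive because $u_m \ge -1/2$; this is what the lower bound is for. *)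
  have -> : step_poly (u m) = u m * (1 + u m - u m ^+ 2) by rewrite /step_poly; ring.
  by rewrite mulr_le0_ge0 //; nra.
have l0 : l <= 0 by apply: limr_le => //; apply: nearW => m; case/andP: (un m).
by case: lE => // l1; lra.
Qed.

End Step.

Lemma cvg_bigsum (R : realType) (I : finType) (f : I -> nat -> R) (l : I -> R) :
  (forall i, f i m @[m --> \oo] --> l i) ->
  \sum_i f i m @[m --> \oo] --> \sum_i l i.
Proof.
move=> fl; elim: (index_enum I) => [|i r IH].
  rewrite big_nil (_ : (fun _ => _) = fun=> 0); first exact: cvg_cst.
  by apply/funext => m; rewrite big_nil.
rewrite big_cons (_ : (fun _ => _) = (fun m => f i m + \sum_(j <- r) f j m)).
  exact: cvgD.
by apply/funext => m; rewrite big_cons.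
Qed.

(** * Polynomials in a diagonalized matrix *)

Section ConjDiag.
Variables (F : fieldType) (n : nat).
Implicit Types (P S : 'M[F]_n) (s t : 'I_n -> F).

(** For fixed invertible [P] these matrices form an algebra computed eigenvalue by eigenvalue, so
    iterating a polynomial on the matrix iterates it on each eigenvalue. *)
Definition conj_diag P s : 'M[F]_n := invmx P *m diag_mx (\row_i s i) *m P.

Lemma conj_diagD P s t :
  conj_diag P s + conj_diag P t = conj_diag P (fun i => s i + t i).
Proof.
rewrite /conj_diag -mulmxDl -mulmxDr -raddfD; congr (_ *m diag_mx _ *m _).
by apply/rowP => i; rewrite !mxE.
Qed.

Lemma conj_diagZ P s (c : F) :
  c *: conj_diag P s = conj_diag P (fun i => c * s i).
Proof.
rewrite /conj_diag scalemxAl scalemxAr -linearZ; congr (_ *m diag_mx _ *m _).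
by apply/rowP => i; rewrite !mxE.
Qed.

Lemma conj_diagN P s : - conj_diag P s = conj_diag P (fun i => - s i).
Proof.
rewrite -scaleN1r conj_diagZ.
by congr conj_diag; apply/funext => i; rewrite mulN1r.
Qed.

Lemma conj_diagM P s t : P \in unitmx ->
  conj_diag P s *m conj_diag P t = conj_diag P (fun i => s i * t i).
Proof.
move=> Pu; rewrite /conj_diag -!mulmxA (mulmxA P (invmx P)) mulmxV // mul1mx.
rewrite (mulmxA (diag_mx _) (diag_mx _)) mulmx_diag.
congr (_ *m (diag_mx _ *m _)).
by apply/rowP => i; rewrite !mxE.
Qed.

Lemma conj_diag_scalar P (c : F) : P \in unitmx ->
  conj_diag P (fun=> c) = c%:M.
Proof.
move=> Pu; rewrite /conj_diag.
have -> : diag_mx (\row_(i < n) c) = c%:M.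
  by rewrite -diag_const_mx; congr diag_mx; apply/rowP => i; rewrite !mxE.
by rewrite -mulmxA mul_scalar_mx -scalemxAr mulVmx // scalemx1.
Qed.

Lemma conj_diag_trace P s : P \in unitmx -> \tr (conj_diag P s) = \sum_i s i.
Proof.
move=> Pu; rewrite /conj_diag mxtrace_mulC mulmxA mulmxV // mul1mx.
by rewrite mxtrace_diag; apply: eq_bigr => i _; rewrite mxE.
Qed.

(** [step_poly] evaluated at a matrix, written without a diagonalization so that its entries depend
    measurably on those of [S]. *)
Definition mstep S := S + S *m S - S *m S *m S.

Lemma iter_mstep P s m : P \in unitmx ->
  iter m mstep (conj_diag P s) = conj_diag P (fun i => iter m (@step_poly F) (s i)).
Proof.
move=> Pu; elim: m => [//|m IH]; rewrite iterS IH /mstep !conj_diagM //.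
rewrite conj_diagN !conj_diagD; congr conj_diag; apply/funext => i.
by rewrite iterS /step_poly expr2 !exprS expr0 mulr1 mulrA.
Qed.

(* The shifted matrix is scaled so that its eigenvalues lie in [-1/2, 1/2]. *)
Definition unit_shift (c : F) (A : 'M[F]_n) : 'M[F]_n :=
  let B := A - c%:M in (2 * (1 + \tr (B *m B)))^-1 *: B.

Lemma unit_shift_conj_diag P s c : P \in unitmx ->
  unit_shift c (conj_diag P s) = conj_diag P
    (fun i => (2 * (1 + \sum_j (s j - c) * (s j - c)))^-1 * (s i - c)).
Proof.
move=> Pu; rewrite /unit_shift.
have -> : conj_diag P s - c%:M = conj_diag P (fun i => s i - c).
  by rewrite -(conj_diag_scalar c Pu) conj_diagN conj_diagD.
by rewrite conj_diagM // conj_diag_trace // conj_diagZ.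
Qed.

End ConjDiag.

Lemma iter_step_real (R : realType) (s : R) m :
  iter m (@step_poly _) s%:C%C = (iter m (@step_poly _) s)%:C%C.
Proof.
elim: m => [//|m IH]; rewrite !iterS IH /step_poly.
by rewrite !rmorphB !rmorphD !rmorphXn.
Qed.

Section EdfMeasurable.
Variables (R : realType) (n : nat).
Local Notation Re := complex.Re.
Implicit Types A : 'M[R[i]]_n.

(** The iterates of the shifted matrix tend to the spectral projection for eigenvalues above [x],
    whose trace counts these eigenvalues. This exhibits [edf] as a limit of explicit expressions in
    the entries. *)
Lemma edf_cvg A x : A \is hermsymmx ->
  (n%:R - Re (\tr (iter m (@mstep _ _) (unit_shift x%:C%C A)))) / n%:R @[m --> \oo] --> edf A x.
Proof.
move=> hA; rewrite edf_spectral //.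
set P := spectralmx A; have Pu : P \in unitmx := spectral_unit A.
pose e i := Re (spectral_diag A 0 i).
have dE i : spectral_diag A 0 i = (e i)%:C%C.
  rewrite /e RRe_real //; exact/mxOverP/hermitian_spectral_diag_real.
have AE : A = conj_diag P (fun i => (e i)%:C%C).
  have dr : spectral_diag A = \row_i (e i)%:C%C by apply/rowP => i; rewrite mxE dE.
  by have /orthomx_spectralP := hermitian_normalmx hA; rewrite -/P dr.
pose y i := e i - x; pose c := (2 * (1 + \sum_i y i * y i))^-1.
have sE : unit_shift x%:C%C A = conj_diag P (fun i => (c * y i)%:C%C).
  have sumE : \sum_j ((e j)%:C%C - x%:C%C) * ((e j)%:C%C - x%:C%C) =
      (\sum_j y j * y j)%:C%C.
    by rewrite rmorph_sum; apply: eq_bigr => j _; rewrite rmorphM rmorphB.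
  rewrite AE (unit_shift_conj_diag _ _ Pu) sumE; congr conj_diag; apply/funext => i.
  by rewrite rmorphM rmorphB /c fmorphV rmorphM !rmorphD !rmorph1.
have q0 : 0 <= \sum_i y i * y i by apply: sumr_ge0 => i _; rewrite -expr2 sqr_ge0.
have c0 : 0 < c by rewrite invr_gt0 mulr_gt0 // ltr_pwDl.
(* With $q = \sum_j y_j^2$ one has $2|y_i| \le 1 + y_i^2 \le 1 + q$, while $2c(1 + q) = 1$. *)
have cy i : - 2^-1 <= c * y i <= 1.
  have yq : y i * y i <= \sum_i y i * y i.
    rewrite (bigD1 i) //= lerDl sumr_ge0 // => j _; by rewrite -expr2 sqr_ge0.
  have cK : c * (2 * (1 + \sum_i y i * y i)) = 1.
    by rewrite mulVf // gt_eqF // mulr_gt0 // ltr_pwDl.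
  move: (\sum_i y i * y i) cK yq q0 => q cK yq q0.
  have cq : c * (y i * y i) <= c * q by rewrite ler_pM2l.
  apply/andP; split.
    have : 0 <= c * (y i + 1) ^+ 2 by rewrite mulr_ge0 ?sqr_ge0 // ltW.
    by nra.
  have : 0 <= c * (y i - 1) ^+ 2 by rewrite mulr_ge0 ?sqr_ge0 // ltW.
  by nra.
(* As [c] is positive, an eigenvalue exceeds [x] exactly when [c * y i] is positive; the others are
   the ones counted by [N]. *)
set N := #|_|; have -> : N%:R = n%:R - \sum_i (0 < c * y i)%R%:R :> R.
  rewrite /N -sum1_card natr_sum big_mkcond /=.
  have -> : n%:R = \sum_(i < n) (1 : R) by rewrite sumr_const card_ord.
  rewrite -sumrB; apply: eq_bigr => i _.
  rewrite inE dE lecR pmulr_rgt0 // /y subr_gt0 leNgt.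
  by case: ltP => _; rewrite ?subrr ?subr0.
apply: cvgM; last exact: cvg_cst.
apply: cvgB; first exact: cvg_cst.
have trE m : Re (\tr (iter m (@mstep _ _) (unit_shift x%:C%C A))) =
    \sum_i iter m (@step_poly R) (c * y i).
  rewrite sE (iter_mstep _ _ Pu) (conj_diag_trace _ Pu).
  under eq_bigr do rewrite iter_step_real.
  by rewrite -rmorph_sum.
under eq_fun do rewrite trE.
exact: cvg_bigsum (fun i => step_poly_cvg (cy i)).
Qed.

Lemma edf_measurable d (T : measurableType d) (H : T -> 'M[R[i]]_n) (x : R) :
    mmeas H -> (forall w, H w \is hermsymmx) ->
  measurable_fun setT (fun w => edf (H w) x).
Proof.
move=> mH hH.
apply: (@measurable_fun_cvg _ _ _ _ (fun m w =>
  (n%:R - Re (\tr (iter m (@mstep _ _) (unit_shift x%:C%C (H w))))) / n%:R)); last first.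
  by move=> w _; exact: edf_cvg.
have tr_meas (F : T -> 'M[R[i]]_n) : mmeas F -> cmeas (fun w => \tr (F w)).
  by move=> mF; apply: cmeas_sum => i; exact: mF.
move=> m; apply: measurable_funM; last exact: measurable_cst.
apply: measurable_funB; first exact: measurable_cst.
suff : mmeas (fun w => iter m (@mstep _ _) (unit_shift x%:C%C (H w))) by move=> /tr_meas[].
have mB : mmeas (fun w => H w - x%:C%C%:M).
  by apply: mmeasD => //; exact: mmeas_cst.
elim: m => [|m IH].
  apply: mmeasZ => //; apply: cmeasV; apply: cmeasM; first exact: cmeas_cst.
  apply: cmeasD; first exact: cmeas_cst.
  by apply: tr_meas; exact: mmeasM.
by apply: mmeasD; [apply: mmeasD => //; exact: mmeasM
  | apply: mmeasN; apply: mmeasM => //; exact: mmeasM].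
Qed.

End EdfMeasurable.

(** * Means of bounded functions *)

Section ExpBounds.
Variable R : realType.
Implicit Types y : R.

(** From $e^{-y/2} \ge 1 - y/2 > 0$ follows $e^y (1 - y/2)^2 \le 1$, and 1 is at most $(1 + y +
    y^2)(1 - y/2)^2$ in this range. *)
Lemma expR_le_quadratic y : y <= 4^-1 -> expR y <= 1 + y + y ^+ 2.
Proof.
move=> y4; set a := expR (- (y / 2)).
have a_ge : 1 - y / 2 <= a by rewrite /a (le_trans _ (expR_ge1Dx _)).
have Ea : expR y * a ^+ 2 = 1.
  rewrite /a -expRM_natl -expRD -[RHS]expR0; congr expR; lra.
have h0 : 0 < 1 - y / 2 by lra.
have b2 : (1 - y / 2) ^+ 2 <= a ^+ 2 by rewrite ler_pXn2r // nnegrE; lra.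
have E0 := expR_gt0 y.
rewrite -(ler_pM2r (exprn_gt0 2 h0)) (le_trans (y := 1)) //.
  by rewrite -[leRHS]Ea ler_pM2l.
have -> : (1 + y + y ^+ 2) * (1 - y / 2) ^+ 2 = 1 + (y / 2) ^+ 2 * (1 - 3 * y + y ^+ 2).
  by field.
by rewrite lerDl mulr_ge0 ?sqr_ge0 //; nra.
Qed.

(** The factor 4 makes $y \le 4y^2$ beyond $1/4$; up to $1/4$ the quadratic bound applies. *)
Lemma expR_le_add y : expR y <= y + expR (4 * y ^+ 2).
Proof.
have [y4|y4] := leP y 4^-1.
  apply: le_trans (expR_le_quadratic y4) _.
  have := expR_ge1Dx (4 * y ^+ 2); have := sqr_ge0 y; lra.
have : expR y <= expR (4 * y ^+ 2) by rewrite ler_expR; nra.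
lra.
Qed.

Lemma sqr_le_expR y : y ^+ 2 <= 4 * (expR y + expR (- y)).
Proof.
wlog y0 : y / 0 <= y => [H|].
  have [/H//|/ltW y0] := leP 0 y.
  have := H (- y); rewrite sqrrN opprK addrC; apply; lra.
have h : 1 + y / 2 <= expR (y / 2) by exact: expR_ge1Dx.
have -> : expR y = expR (y / 2) ^+ 2.
  by rewrite -expRM_natl; congr expR; lra.
have := expR_ge0 (- y); nra.
Qed.
End ExpBounds.

Section Mean.
Context (R : realType).

(** Such functions are integrable for every probability measure, so their means can be handled as
    real numbers. *)
Definition bmeas d (T : measurableType d) (f : T -> R) :=
  measurable_fun setT f /\ exists K, forall x, `|f x| <= K.

Lemma bmeas_comp d d' (T : measurableType d) (T' : measurableType d')
  (f : T' -> R) (g : T -> T') :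
  bmeas f -> measurable_fun setT g -> bmeas (fun x => f (g x)).
Proof.
move=> [mf [K fK]] mg; split; first exact: measurableT_comp.
by exists K => x; exact: fK.
Qed.

Context d (T : measurableType d).
Implicit Types (f g : T -> R) (D : set T) (P : probability T R).

Lemma bmeas_cst (r : R) : bmeas (fun _ : T => r).
Proof. by split; [exact: measurable_cst | exists `|r|]. Qed.

Lemma bmeas_affine (a b : R) f : bmeas f -> bmeas (fun x => a * f x + b).
Proof.
move=> [mf [K fK]]; split.
  apply: measurable_funD; last exact: measurable_cst.
  by apply: measurable_funM => //; exact: measurable_cst.
exists (`|a| * K + `|b|) => x; apply: le_trans (ler_normD _ _) _.
by rewrite lerD2r normrM ler_wpM2l.
Qed.

Lemma bmeas_expR (l : R) f : bmeas f -> bmeas (fun x => expR (l * f x)).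
Proof.
move=> [mf [K fK]]; split.
  apply: measurableT_comp; first exact: measurable_expR.
  by apply: measurable_funM => //; exact: measurable_cst.
exists (expR (`|l| * K)) => x; rewrite ger0_norm ?expR_ge0 // ler_expR.
by rewrite (le_trans (ler_norm _)) // normrM ler_wpM2l.
Qed.

Lemma bmeas_sqr f : bmeas f -> bmeas (fun x => f x ^+ 2).
Proof.
move=> [mf [K fK]]; split; first exact: measurable_funX.
by exists (K ^+ 2) => x; rewrite normrX lerXn2r // nnegrE (le_trans _ (fK x)).
Qed.

Lemma bmeas_integrable P f : bmeas f -> P.-integrable setT (EFin \o f).
Proof.
move=> [mf [K fK]]; apply: measurable_bounded_integrable => //.
  by apply: le_lt_trans (probability_le1 P measurableT) _; exact: ltry.
by exists K; split; [exact: num_real | move=> M KM x _; exact: le_trans (fK x) (ltW KM)].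
Qed.

Lemma integral_mean P f : bmeas f ->
  (\int[P]_x (f x)%:E = (\int[P]_x f x)%R%:E)%E.
Proof.
move=> bf; rewrite /Rintegral fineK //.
by apply: integrable_fin_num => //; exact: bmeas_integrable.
Qed.

Lemma integral_prob_cst P (r : R) : (\int[P]_x r%:E = r%:E)%E.
Proof. by rewrite (integral_cst P) // [X in (_ * X)%E]probability_setT mule1. Qed.

Lemma mean_affine P (a b : R) f : bmeas f ->
  \int[P]_x (a * f x + b) = a * (\int[P]_x f x) + b.
Proof.
move=> bf; apply: EFin_inj; rewrite -integral_mean; last exact: bmeas_affine.
under eq_integral do rewrite EFinD EFinM.
have fi := bmeas_integrable P bf.
have ci : P.-integrable setT (EFin \o (fun=> b)).
  by apply: finite_measure_integrable_cst.
rewrite integralD //; last exact: integrableZl.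
by rewrite integralZl // integral_prob_cst integral_mean // EFinD EFinM.
Qed.

Lemma bmeasD f g : bmeas f -> bmeas g -> bmeas (fun x => f x + g x).
Proof.
move=> [mf [K fK]] [mg [L gL]]; split; first exact: measurable_funD.
by exists (K + L) => x; rewrite (le_trans (ler_normD _ _)) // lerD.
Qed.

Lemma meanD P f g : bmeas f -> bmeas g ->
  \int[P]_x (f x + g x) = \int[P]_x f x + \int[P]_x g x.
Proof. by move=> bf bg; rewrite RintegralD //; exact: bmeas_integrable. Qed.

Lemma prob1_ae P D : measurable D -> (P D = 1)%E -> \forall x \ae P, D x.
Proof.
move=> mD PD; exists (~` D); split; first exact: measurableC.
  by rewrite probability_setC // PD subee.
by move=> x.
Qed.

Lemma mean_le P f g D : bmeas f -> bmeas g -> measurable D -> (P D = 1)%E ->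
  (forall x, D x -> f x <= g x) -> \int[P]_x f x <= \int[P]_x g x.
Proof.
move=> bf bg mD PD fg; have [[_ [K fK]] [_ [L gL]]] := (bf, bg).
(* Adding a common bound makes both functions nonnegative, as the almost everywhere comparison of
   integrals requires. *)
pose M := Num.max K L.
rewrite -(lerD2r M) -[X in X + _]mul1r -[X in _ <= X + _]mul1r -!mean_affine //.
have bf' := bmeas_affine 1 M bf; have bg' := bmeas_affine 1 M bg.
have ge0 (h : T -> R) (H : R) : (forall x, `|h x| <= H) -> H <= M ->
    forall x, setT x -> (0 <= (1 * h x + M)%:E)%E.
  move=> hH HM x _; rewrite lee_fin mul1r -lerBlDr add0r.
  by have := le_trans (hH x) HM; rewrite ler_norml => /andP[].
rewrite -lee_fin -!integral_mean //; apply: ae_ge0_le_integral => //.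
- by apply: ge0 fK _; rewrite le_max lexx.
- by apply/measurable_EFinP; case: bf'.
- by apply: ge0 gL _; rewrite le_max lexx orbT.
- by apply/measurable_EFinP; case: bg'.
have := prob1_ae mD PD; apply: filterS => x Dx _.
by rewrite lee_fin !mul1r lerD2r fg.
Qed.

Lemma mean_eq P f g D : bmeas f -> bmeas g -> measurable D -> (P D = 1)%E ->
  (forall x, D x -> f x = g x) -> \int[P]_x f x = \int[P]_x g x.
Proof.
move=> bf bg mD PD fg; apply/eqP; rewrite eq_le.
by rewrite !(mean_le (D := D)) // => x Dx; rewrite fg.
Qed.

Lemma mean_cst P (r : R) : \int[P]_x r = r.
Proof. by rewrite /Rintegral integral_prob_cst. Qed.

(* Hoeffding's lemma, with a cruder constant: [expR y <= y + expR (4 * y ^+ 2)]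
   at [y = l * (f - mean)] gets rid of the first order term by integration. *)
Lemma mgf_oscillation P f D (c l : R) : bmeas f -> measurable D -> (P D = 1)%E ->
    (forall x y, D x -> D y -> f x - f y <= c) ->
  \int[P]_x expR (l * f x) <= expR (4 * (l * c) ^+ 2 + l * \int[P]_x f x).
Proof.
move=> bf mD PD fc; set m := \int[P]_x f x.
(* Averaging the oscillation bound over one of its two points places every value of [f] on [D]
   within [c] of the mean. *)
have le1 x : D x -> f x <= m + c.
  move=> Dx; rewrite -(mean_cst P (f x)) -[X in X + _]mul1r -mean_affine //.
  apply: (mean_le (D := D)) => //; [|exact: bmeas_affine|].
    exact: bmeas_cst.
  by move=> y Dy; rewrite mul1r -lerBlDl fc.
have le2 x : D x -> m <= f x + c.
  move=> Dx; rewrite -(mean_cst P (f x + c)).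
  apply: (mean_le (D := D)) => //.
    exact: bmeas_cst.
  by move=> y Dy; rewrite -lerBlDl fc.
set K := expR (4 * (l * c) ^+ 2).
(* The bound becomes the mean of an affine function of [f], so a pointwise comparison on [D]
   suffices. *)
have -> : expR (4 * (l * c) ^+ 2 + l * m) =
    (expR (l * m) * l) * m + expR (l * m) * (K - l * m).
  rewrite expRD -/K; ring.
rewrite -mean_affine //; apply: (mean_le (D := D)) => //.
- exact: bmeas_expR.
- exact: bmeas_affine.
move=> x Dx; have -> : l * f x = l * m + l * (f x - m) by ring.
rewrite expRD -mulrA -mulrDr ler_pM2l ?expR_gt0 //.
apply: le_trans (expR_le_add _) _.
have -> : l * f x + (K - l * m) = l * (f x - m) + K by ring.
rewrite lerD2l /K ler_expR ler_pM2l // !exprMn ler_wpM2l ?sqr_ge0 //.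
by have := le1 _ Dx; have := le2 _ Dx; nra.
Qed.

End Mean.

(** * Iterated means and product measures *)

Section Fubini.
Context (R : realType) d1 d2 (T1 : measurableType d1) (T2 : measurableType d2).
Variables (P : probability T1 R) (Q : probability T2 R) (F : T1 * T2 -> R).
Hypothesis bF : bmeas F.

Let K := projT1 (cid bF.2).
Let FK z : `|F z| <= K := projT2 (cid bF.2) z.

(** Shifted by its bound, the integrand is nonnegative and Tonelli applies; the factor 1 gives the
    form in which [mean_affine] removes the shift. *)
Let F' z := (1 * F z + K)%:E.
Let bF' : bmeas (fun z => 1 * F z + K) := bmeas_affine 1 K bF.
Let mF' : measurable_fun setT F'.
Proof. by apply/measurable_EFinP; case: bF'. Qed.
Let F'0 z : (0 <= F' z)%E.
Proof.
rewrite lee_fin mul1r -lerBlDr add0r.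
by have := FK z; rewrite ler_norml => /andP[].
Qed.

Let bx x : bmeas (fun y => F (x, y)).
Proof. exact: bmeas_comp. Qed.
Let by_ y : bmeas (fun x => F (x, y)).
Proof. exact: bmeas_comp. Qed.

Let mean_norm d (T : measurableType d) (mu : probability T R) (f : T -> R) :
  bmeas f -> (forall x, `|f x| <= K) -> `|\int[mu]_x f x| <= K.
Proof.
move=> bf fK.
rewrite ler_norml -[- K](mean_cst mu) -[X in _ && (_ <= X)](mean_cst mu).
apply/andP; split; apply: (mean_le (D := setT)) => //; try exact: probability_setT;
  try exact: bmeas_cst.
  by move=> x _; have := fK x; rewrite ler_norml => /andP[].
by move=> x _; have := fK x; rewrite ler_norml => /andP[].
Qed.

Lemma bmeas_meanl : bmeas (fun x => \int[Q]_y F (x, y)).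
Proof.
split; last by exists K => x; exact: mean_norm.
have -> : (fun x => \int[Q]_y F (x, y)) =
    fun x => 1 * fine (fubini_F Q F' x) + - K.
  apply/funext => x; rewrite /fubini_F /F' /=.
  by rewrite -[fine _]/(\int[Q]_y (1 * F (x, y) + K)) mean_affine //; ring.
apply: measurable_funD; last exact: measurable_cst.
apply: measurable_funM; first exact: measurable_cst.
apply: measurableT_comp; first exact: fine_measurable.
exact: measurable_fun_fubini_tonelli_F.
Qed.

Lemma bmeas_meanr : bmeas (fun y => \int[P]_x F (x, y)).
Proof.
split; last by exists K => x; exact: mean_norm.
have -> : (fun y => \int[P]_x F (x, y)) =
    fun y => 1 * fine (fubini_G P F' y) + - K.
  apply/funext => y; rewrite /fubini_G /F' /=.
  by rewrite -[fine _]/(\int[P]_x (1 * F (x, y) + K)) mean_affine //; ring.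
apply: measurable_funD; last exact: measurable_cst.
apply: measurable_funM; first exact: measurable_cst.
apply: measurableT_comp; first exact: fine_measurable.
exact: measurable_fun_fubini_tonelli_G.
Qed.

Let innerl x : (\int[Q]_y F' (x, y) = (1 * (\int[Q]_y F (x, y))%R + K)%:E)%E.
Proof.
rewrite -mean_affine // -integral_mean //.
exact: (bmeas_affine 1 K (bx x)).
Qed.

Let innerr y : (\int[P]_x F' (x, y) = (1 * (\int[P]_x F (x, y))%R + K)%:E)%E.
Proof.
rewrite -mean_affine // -integral_mean //.
exact: (bmeas_affine 1 K (by_ y)).
Qed.

Lemma mean_fubini :
  \int[P]_x \int[Q]_y F (x, y) = \int[Q]_y \int[P]_x F (x, y).
Proof.
have h := fubini_tonelli (m1 := P) (m2 := Q) F' mF' F'0.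
rewrite (eq_integral _ _ (fun x _ => innerl x)) in h.
rewrite (eq_integral _ _ (fun x _ => innerr x)) in h.
have bl := bmeas_meanl; have br := bmeas_meanr.
rewrite !integral_mean ?mean_affine // in h; try exact: bmeas_affine.
by case: h => /addIr; rewrite !mul1r.
Qed.

Lemma mean_prod :
  \int[(P \x Q)%E]_z F z = \int[P]_x \int[Q]_y F (x, y).
Proof.
have h := fubini_tonelli1 (m1 := P) (m2 := Q) F' mF' F'0.
rewrite (eq_integral _ _ (fun x _ => innerl x)) in h.
have bl := bmeas_meanl.
rewrite !integral_mean ?mean_affine // in h; try exact: bmeas_affine.
by case: h => /addIr; rewrite !mul1r.
Qed.

End Fubini.

(** * Haar measures on the stabilizers *)

Section Haar.
Variables (R : realType) (n : nat).
Local Notation M := (matT R n).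
Implicit Types (nu : probability M R) (f : M -> R) (U V W : 'M[R[i]]_n).

Lemma mmeas_id : mmeas (fun U : M => (U : 'M[R[i]]_n)).
Proof. by apply/(@mmeasP R _ M n id); exact: measurable_id. Qed.

Lemma measurable_mulmx d (T : measurableType d) (F G : T -> M) :
  measurable_fun setT F -> measurable_fun setT G ->
  measurable_fun setT (fun t => (F t *m G t : M)).
Proof. by move=> /mmeasP mF /mmeasP mG; apply/mmeasP; exact: mmeasM. Qed.

Lemma measurable_adjmx d (T : measurableType d) (F : T -> M) :
  measurable_fun setT F -> measurable_fun setT (fun t => (adjmx (F t) : M)).
Proof. by move=> /mmeasP mF; apply/mmeasP; exact: mmeas_adj. Qed.

Lemma measurable_mmeas_eq d (T : measurableType d) m p
    (F : T -> 'M[R[i]]_(m, p)) A :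
  mmeas F -> measurable [set t | F t = A].
Proof.
move=> mF.
have -> : [set t | F t = A] = \bigcap_(ij in [set: 'I_m * 'I_p])
    ((fun t => complex.Re (F t ij.1 ij.2)) @^-1` [set complex.Re (A ij.1 ij.2)] `&`
     (fun t => complex.Im (F t ij.1 ij.2)) @^-1` [set complex.Im (A ij.1 ij.2)]).
  apply/seteqP; split => [t /= tA ij _|t h] /=; first by rewrite tA.
  apply/matrixP => i j.
  have [/= hR hI] := h (i, j) I.
  by apply/eqP; rewrite eq_complex hR hI !eqxx.
apply: fin_bigcap_measurable => // -[i j] _ /=.
have [mR mI] := mF i j.
by apply: measurableI; rewrite -[X in measurable X]setTI;
  [apply: mR|apply: mI].
Qed.

Definition stab_set k : set M := [set U | stab k (U : 'M[R[i]]_n)].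

Lemma measurable_stab k : measurable (stab_set k).
Proof.
have -> : stab_set k = [set U : M | U *m adjmx U = 1%:M] `&`
    \bigcap_(j in [set j : 'I_n | (j < k)%N])
      [set U : M | U *m delta_mx j 0 = delta_mx j 0 :> 'cV_n].
  apply/seteqP; split => [U [/unitarymxP hU fU]|U [hU fU]]; first by split.
  by split; [exact/unitarymxP | exact: fU].
apply: measurableI.
  by apply: measurable_mmeas_eq; apply: mmeasM; [|apply: mmeas_adj]; exact: mmeas_id.
apply: fin_bigcap_measurable; first exact: finite_finset.
move=> j _; apply: measurable_mmeas_eq.
by apply: mmeasM; [exact: mmeas_id | exact: mmeas_cst].
Qed.

(** Haar measure on $G_k$, viewed as a measure on all matrices; [k = 0] gives [haar]. *)
Definition subhaar k nu := (nu (stab_set k) = 1)%E /\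
  forall W, stab k W -> forall S : set M, measurable S ->
    nu ((fun U : M => (W *m U : M)) @^-1` S) = nu S.

Lemma haar_subhaar nu : haar nu -> subhaar 0 nu.
Proof.
move=> [nu1 nuM]; have e : stab_set 0 = [set U : M | (U : 'M[R[i]]_n) \is unitarymx].
  by apply/seteqP; split => U; [case | split].
by split; [rewrite e | move=> W [hW _]; exact: nuM].
Qed.

Lemma mean_pushforward nu (nu' : probability M R) (g : M -> M) f :
    measurable_fun setT g ->
    (forall S, measurable S -> nu' S = nu (g @^-1` S)) -> bmeas f ->
  \int[nu']_U f U = \int[nu]_U f (g U).
Proof.
move=> mg e bf; have [mf _] := bf; rewrite /Rintegral; congr fine.
rewrite (eq_measure_integral (pushforward nu g)); last by move=> S mS _; exact: e.
have -> := integral_pushforward mg (mu := nu) (D := setT) (f := EFin \o f) => //.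
  exact/measurable_EFinP.
rewrite preimage_setT; apply: bmeas_integrable; exact: bmeas_comp.
Qed.

Lemma mean_invl k nu W f : subhaar k nu -> stab k W -> bmeas f ->
  \int[nu]_U f (W *m U) = \int[nu]_U f U.
Proof.
move=> [_ nuM] sW bf; apply/esym; apply: mean_pushforward => //.
  by apply: measurable_mulmx; [exact: measurable_cst | exact: measurable_id].
by move=> S mS; rewrite nuM.
Qed.

(* Left invariance alone: average [f (V^* U)] over independent [U] and [V]. *)
Lemma mean_adj k nu f : subhaar k nu -> bmeas f ->
  \int[nu]_U f (adjmx U) = \int[nu]_U f U.
Proof.
move=> hnu bf; have [nu1 _] := hnu; have mS := measurable_stab k.
have mVU : measurable_fun setT (fun z : M * M => (adjmx z.1 *m z.2 : M)).
  apply: measurable_mulmx; last exact: measurable_snd.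
  by apply: measurable_adjmx; exact: measurable_fst.
have bF := bmeas_comp bf mVU.
have bfa : bmeas (fun U : M => f (adjmx U)).
  by apply: (bmeas_comp bf); apply: measurable_adjmx; exact: measurable_id.
have bcst (r : R) : bmeas (fun _ : M => r) by exact: bmeas_cst.
have := mean_fubini nu nu bF => /=.
rewrite (mean_eq (g := fun=> \int[nu]_U f U) (bmeas_meanl nu bF) _ mS nu1) //; last first.
  by move=> V sV; exact: (mean_invl hnu (stab_adj sV) bf).
rewrite mean_cst => ->.
rewrite (mean_eq (g := fun=> \int[nu]_V f (adjmx V)) (bmeas_meanr nu bF) _ mS nu1) //.
  by rewrite mean_cst.
(* Here $V^* U$ is the adjoint of $U^* V$, so left invariance in [V] applies to [f] composed with
   the adjoint. *)
move=> U sU; rewrite -(mean_invl hnu (stab_adj sU) bfa).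
apply: eq_Rintegral => V _; congr f.
by rewrite /adjmx trmx_mul map_mxM /= trmxCK.
Qed.

(** The adjoint turns right translation by [W] into left translation by $W^*$ and preserves means by
    [mean_adj]. *)
Lemma mean_invr k nu W f : subhaar k nu -> stab k W -> bmeas f ->
  \int[nu]_U f (U *m W) = \int[nu]_U f U.
Proof.
move=> hnu sW bf.
have bfW : bmeas (fun U : M => f (U *m W)).
  by apply: (bmeas_comp bf); apply: measurable_mulmx;
    [exact: measurable_id | exact: measurable_cst].
have bfa : bmeas (fun U : M => f (adjmx U)).
  by apply: (bmeas_comp bf); apply: measurable_adjmx; exact: measurable_id.
rewrite -(mean_adj hnu bfW) -(mean_adj hnu bf) -(mean_invl hnu (stab_adj sW) bfa).
apply: eq_Rintegral => U _; congr f.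
by rewrite /adjmx trmx_mul map_mxM /= trmxCK.
Qed.

Lemma measurable_stab_proj (j : 'I_n) :
  measurable_fun setT (fun U : M => (stab_proj j U : M)).
Proof.
apply/mmeasP; rewrite /stab_proj; apply: mmeasM; first exact: mmeas_id.
have mw : mmeas (fun U : M => ((U : 'M[R[i]]_n) ^t*)%sesqui *m delta_mx j 0 : 'cV_n).
  by apply: mmeasM; [apply: mmeas_adj; exact: mmeas_id | exact: mmeas_cst].
have md := mmeasD (mmeas_cst _ (delta_mx j 0)) (mmeasN mw).
rewrite /refl; apply: mmeasD; first exact: mmeas_cst.
apply: mmeasN; apply: mmeasZ; last by apply: mmeasM => //; exact: mmeas_adj.
apply: cmeasV; apply: cmeasD; first exact: cmeas_cst.
apply: cmeasN; rewrite /cdot.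
by apply: (mmeasM (mmeas_adj mw)); exact: mmeas_cst.
Qed.

(** The image of [nu] under [stab_proj] lives on the smaller stabilizer, and its left invariance
    comes from the equivariance [stab_projM]. *)
Lemma subhaar_succ (j : 'I_n) nu : subhaar j nu ->
  exists nu' : probability M R, subhaar j.+1 nu'.
Proof.
move=> [nu1 nuM]; have mg := measurable_stab_proj j.
pose X := mfun_Sub (mem_set mg).
exists (distribution nu X); split.
  apply/eqP; rewrite eq_le probability_le1 /=; last exact: measurable_stab.
  rewrite -nu1 /distribution /pushforward /=; apply: le_measure.
  - by rewrite inE; exact: measurable_stab.
  - rewrite inE -[X in measurable X]setTI; apply: measurable_stab_proj => //.
    exact: measurable_stab.
  - by move=> U sU; exact: stab_projP.
move=> W sW S mS; rewrite /distribution /pushforward /=.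
have mS' : measurable ((fun U : M => (stab_proj j U : M)) @^-1` S).
  by rewrite -[X in measurable X]setTI; exact: measurable_stab_proj.
apply: etrans (nuM _ (stabS sW) _ mS').
by congr (nu _); apply/seteqP; split => U /=; rewrite stab_projM.
Qed.

End Haar.

(** * Concentration *)

Section HaarConcentration.
Variables (R : realType) (n : nat).
Local Notation M := (matT R n).
Implicit Types (nu : probability M R) (f : M -> R) (U V W : 'M[R[i]]_n).

Lemma bmeas_mulmx f U : bmeas f -> bmeas (fun V : M => f (U *m V)).
Proof.
move=> bf; apply: (bmeas_comp bf).
by apply: measurable_mulmx; [exact: measurable_cst | exact: measurable_id].
Qed.

Lemma bmeas_mulmx2 f : bmeas f -> bmeas (fun z : M * M => f (z.1 *m z.2)).
Proof.
move=> bf; apply: (bmeas_comp bf).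
by apply: measurable_mulmx; [exact: measurable_fst | exact: measurable_snd].
Qed.

(** Integrating over [U] first, right invariance absorbs [V]. With [nu'] on $G_{k+1}$ this splits a
    mean over $G_k$ into means over cosets. *)
Lemma mean_convolution k nu nu' f : subhaar k nu -> (nu' (stab_set k) = 1)%E ->
  bmeas f -> \int[nu]_U \int[nu']_V f (U *m V) = \int[nu]_U f U.
Proof.
move=> hnu nu1 bf; have bF := bmeas_mulmx2 bf.
have /= -> := mean_fubini nu nu' bF.
rewrite (mean_eq (g := fun=> \int[nu]_U f U) (bmeas_meanr nu bF)
  (bmeas_cst _ _) (@measurable_stab R n k) nu1).
  by rewrite mean_cst.
by move=> V sV; exact: mean_invr hnu sV bf.
Qed.

(** Left invariance of [nu] makes the coset means of [V] and of [W *m U] equal, with [W] from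
    [stab_link]; then [U *m X] and [W *m U *m X] differ by rank at most 1 for every [X]. *)
Lemma oscillation_coset (k : 'I_n) nu f (c : R) : subhaar k.+1 nu -> bmeas f ->
    (forall U V, (\rank (U - V)%R <= 1)%N -> f U - f V <= c) ->
  forall U V, stab k U -> stab k V ->
  \int[nu]_W f (U *m W) - \int[nu]_W f (V *m W) <= c.
Proof.
move=> hnu bf fc U V sU sV; have [W rW sW] := stab_link sU sV.
have [hV _] := sV.
rewrite -(mean_invl hnu sW (bmeas_mulmx V bf)) lerBlDl.
have e : (fun X : M => f (V *m ((V ^t*)%sesqui *m (W *m U) *m X))) =
         (fun X : M => f (W *m U *m X)).
  by apply/funext => X; rewrite !mulmxA (unitarymxP hV) mul1mx.
rewrite e -[X in X + c]mul1r -mean_affine; last exact: bmeas_mulmx.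
apply: (mean_le (D := setT)) => //; last 2 first.
- exact: probability_setT.
- move=> X _; rewrite mul1r addrC -lerBlDr; apply: fc.
  rewrite -mulmxBl; apply: leq_trans (mxrankM_maxl _ _) _.
  rewrite -[X in X - _]mul1mx -mulmxBl; apply: leq_trans (mxrankM_maxl _ _) _.
  by rewrite -opprB mxrank_opp.
- exact: bmeas_mulmx.
- by apply: bmeas_affine; exact: bmeas_mulmx.
Qed.

(** Descent along the chain with [m = n - k] steps left: the induction hypothesis bounds the mean
    over each coset $U G_{k+1}$, and [mgf_oscillation] treats the coset mean as a function of [U].
    Each step costs one factor $e^{4(lc)^2}$; [c] stays the same because left multiplication does
    not increase rank. *)
Lemma subhaar_mgf m : forall k nu f (c l : R), (k + m)%N = n ->
    subhaar k nu -> bmeas f ->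
    (forall U V, (\rank (U - V)%R <= 1)%N -> f U - f V <= c) ->
  \int[nu]_U expR (l * f U) <=
  expR (4 * m%:R * (l * c) ^+ 2 + l * \int[nu]_U f U).
Proof.
elim: m => [|m IH] k nu f c l km hnu bf fc.
  (* Here [k = n], the stabilizer is trivial and [f] is almost surely constant. *)
  rewrite addn0 in km; rewrite mulr0 mul0r add0r.
  have [nu1 _] := hnu; have mS := @measurable_stab R n k.
  have fe U : stab_set k U -> f U = f 1%:M by rewrite /stab_set km => /stab_full ->.
  rewrite (mean_eq bf (bmeas_cst _ (f 1%:M)) mS nu1 fe).
  rewrite (mean_eq (bmeas_expR l bf) (bmeas_cst _ (expR (l * f 1%:M))) mS nu1).
    by rewrite !mean_cst.
  by move=> U /fe ->.
have kn : (k < n)%N by rewrite -km addnS ltnS leq_addr.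
pose j := Ordinal kn.
have [nu' hnu'] := @subhaar_succ R n j nu hnu.
have [nu1 _] := hnu; have [nu1' _] := hnu'.
have nu1k : (nu' (stab_set k) = 1)%E.
  apply/eqP; rewrite eq_le probability_le1 /=; last exact: measurable_stab.
  rewrite -nu1'; apply: le_measure; rewrite ?inE; try exact: measurable_stab.
  by move=> U; exact: stabS.
have ble := bmeas_expR l bf.
have bl := bmeas_meanl nu' (bmeas_mulmx2 bf).
rewrite -(mean_convolution hnu nu1k ble) -(mean_convolution hnu nu1k bf).
set K := 4 * m%:R * (l * c) ^+ 2.
apply: (@le_trans _ _
    (\int[nu]_U (expR K * expR (l * \int[nu']_V f (U *m V)) + 0))).
  apply: (mean_le (D := setT)) => //; last 2 first.
  - exact: probability_setT.
  - move=> U _; rewrite addr0 -expRD.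
    apply: (IH k.+1 nu' (fun V : M => f (U *m V)) c l) => //.
    + by rewrite addSnnS.
    + exact: bmeas_mulmx.
    + move=> V W rVW; apply: fc.
      by rewrite -mulmxBr (leq_trans (mxrankM_maxr _ _)).
  - exact: (bmeas_meanl nu' (bmeas_mulmx2 ble)).
  - exact: (bmeas_affine _ _ (bmeas_expR l bl)).
rewrite (mean_affine nu (expR K) 0 (bmeas_expR l bl)) addr0.
have osc := mgf_oscillation l bl (@measurable_stab R n k) nu1
  (@oscillation_coset j nu' f c hnu' bf fc).
apply: le_trans (ler_wpM2l (expR_ge0 K) osc) _.
rewrite -expRD ler_expR le_eqVlt; apply/orP; left; apply/eqP.
by rewrite /K /= -natr1; ring.
Qed.

Lemma haar_mgf nu f (c l : R) : haar nu -> bmeas f ->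
    (forall U V, (\rank (U - V)%R <= 1)%N -> f U - f V <= c) ->
  \int[nu]_U expR (l * f U) <=
  expR (4 * n%:R * (l * c) ^+ 2 + l * \int[nu]_U f U).
Proof. by move=> /haar_subhaar hnu; apply: subhaar_mgf hnu. Qed.

(** [haar_mgf] is used in [V] for fixed [U], then in [U] for the mean over [V], which inherits the
    bounded difference [c]; the two costs add up to the constant 8. *)
Lemma haar_prod_mgf nu (F : M * M -> R) (c l : R) : haar nu -> bmeas F ->
    (forall U U' V V', (\rank (U - U')%R <= 1)%N -> (\rank (V - V')%R <= 1)%N ->
      F (U, V) - F (U', V) <= c /\ F (U, V) - F (U, V') <= c) ->
  \int[(nu \x nu)%E]_w expR (l * F w) <=
  expR (8 * n%:R * (l * c) ^+ 2 + l * \int[(nu \x nu)%E]_w F w).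
Proof.
move=> hnu bF Fc.
have r0 U : (\rank (U - U)%R <= 1)%N by rewrite subrr mxrank0.
have bl := bmeas_meanl nu bF.
have bFx U : bmeas (fun V : M => F (U, V)) by exact: (bmeas_comp bF (@pair1_measurable _ _ M M U)).
rewrite (mean_prod nu nu (bmeas_expR l bF)) (mean_prod nu nu bF).
set K := 4 * n%:R * (l * c) ^+ 2.
apply: (@le_trans _ _
    (\int[nu]_U (expR K * expR (l * \int[nu]_V F (U, V)) + 0))).
  apply: (mean_le (D := setT)) => //; last 2 first.
  - exact: probability_setT.
  - move=> U _; rewrite addr0 -expRD; apply: (@haar_mgf nu (fun V : M => F (U, V)) c l hnu (bFx U)).
    by move=> V V' rV; exact: (Fc U U V V' (r0 _) rV).2.
  - exact: (bmeas_meanl nu (bmeas_expR l bF)).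
  - exact: (bmeas_affine _ _ (bmeas_expR l bl)).
rewrite (mean_affine nu (expR K) 0 (bmeas_expR l bl)) addr0.
have : \int[nu]_U expR (l * \int[nu]_V F (U, V)) <=
    expR (K + l * \int[nu]_U \int[nu]_V F (U, V)).
  apply: (@haar_mgf nu (fun U : M => \int[nu]_V F (U, V)) c l hnu bl) => U U' rU.
  rewrite lerBlDl -[X in X + c]mul1r -mean_affine //.
  apply: (mean_le (D := setT)) => //; last 2 first.
  - exact: probability_setT.
  - move=> V _; rewrite mul1r addrC -lerBlDr.
    exact: (Fc U U' V V rU (r0 _)).1.
  - exact: (bmeas_affine 1 c (bFx U')).
move/(ler_wpM2l (expR_ge0 K))/le_trans; apply.
rewrite -expRD ler_expR le_eqVlt; apply/orP; left; apply/eqP.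
by rewrite /K; ring.
Qed.

End HaarConcentration.

(** * Variance and tails from a subgaussian moment generating function *)

Section Subgaussian.
Context (R : realType) d (T : measurableType d) (P : probability T R).
Variables (F : T -> R) (s : R).
Hypotheses (bF : bmeas F) (s0 : 0 < s).
Local Notation m := (\int[P]_w F w).
Hypothesis mgf : forall l, \int[P]_w expR (l * F w) <= expR (s * l ^+ 2 + l * m).

Let bc (l : R) : bmeas (fun w => expR (l * (F w - m))).
Proof.
apply: bmeas_expR; have := bmeas_affine 1 (- m) bF.
by under eq_fun do rewrite mul1r.
Qed.

Let centred_mgf (l : R) :
  \int[P]_w expR (l * (F w - m)) <= expR (s * l ^+ 2).
Proof.
have e : (fun w => expR (l * (F w - m))) =
    (fun w => expR (- (l * m)) * expR (l * F w) + 0).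
  by apply/funext => w; rewrite addr0 -expRD; congr expR; ring.
rewrite e mean_affine; last exact: bmeas_expR.
rewrite addr0; apply: le_trans (ler_wpM2l (expR_ge0 _) (mgf l)) _.
by rewrite -expRD addrCA addNr addr0.
Qed.

Let bcosh (l a : R) : bmeas (fun w =>
  a * (expR (l * (F w - m)) + expR (- l * (F w - m))) + 0).
Proof. by apply: bmeas_affine; apply: bmeasD; exact: bc. Qed.

(** With suitable [l] and [a], this symmetric exponential dominates the squared deviation as well as
    the indicator of a large deviation, hence serves both bounds below. *)
Let mean_cosh (l a : R) : 0 <= a ->
  \int[P]_w (a * (expR (l * (F w - m)) + expR (- l * (F w - m))) + 0) <=
  a * (2 * expR (s * l ^+ 2)).
Proof.
move=> a0; rewrite mean_affine; last by apply: bmeasD; exact: bc.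
rewrite addr0 ler_wpM2l // meanD //.
have := centred_mgf l; have := centred_mgf (- l); rewrite sqrrN; lra.
Qed.

Lemma subgaussian_variance :
  \int[P]_w (F w - m) ^+ 2 <= 8 * expR 1 * s.
Proof.
(* This choice gives [s * l ^+ 2 = 1], whence the factor [expR 1]. *)
pose l := Num.sqrt s^-1.
have l2 : l ^+ 2 = s^-1 by rewrite sqr_sqrtr // invr_ge0 ltW.
have := mean_cosh l (a := 4 * s) _; rewrite l2 mulfV ?gt_eqF // => h.
have -> : 8 * expR 1 * s = 4 * s * (2 * expR 1) by ring.
apply: le_trans (h _); last by rewrite mulr_ge0 // ltW.
apply: (mean_le (D := setT)) => //; last 2 first.
- exact: probability_setT.
- move=> w _; rewrite addr0 mulrAC mulNr.
  have := sqr_le_expR (l * (F w - m)).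
  by rewrite exprMn l2 mulrC ler_pdivrMr.
- apply: bmeas_sqr; have := bmeas_affine 1 (- m) bF.
  by under eq_fun do rewrite mul1r.
Qed.

Lemma subgaussian_tail (t : R) : 0 <= t ->
  (P [set w | (t <= `|F w - m|)%R] <= (2 * expR (- (t ^+ 2) / (4 * s)))%:E)%E.
Proof.
move=> t0; set A := [set w | _].
have [mF _] := bF.
have mA : measurable A.
  have mN : measurable_fun setT (fun w => `|F w - m|).
    apply: measurableT_comp; first exact: normr_measurable.
    by apply: measurable_funB => //; exact: measurable_cst.
  have -> : A = (fun w => `|F w - m|) @^-1` `[t, +oo[%classic.
    by apply/seteqP; split => w; rewrite /A /= in_itv /= andbT.
  by rewrite -[X in measurable X]setTI; apply: mN.
have bA : bmeas (\1_A : T -> R).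
  split; first exact: measurable_indic.
  by exists 1 => w; rewrite indicE ger0_norm // lern1; case: (_ \in _).
have -> : P A = (\int[P]_w (\1_A w))%R%:E.
  by rewrite -integral_mean // integral_indic // setIT.
(* Chernoff's choice: [l] minimizes $s l^2 - l t$, with minimum $-t^2/(4s)$. *)
rewrite lee_fin; pose l := t / (2 * s).
have s2 : s != 0 by rewrite gt_eqF.
have -> : 2 * expR (- (t ^+ 2) / (4 * s)) =
    expR (- (l * t)) * (2 * expR (s * l ^+ 2)).
  rewrite mulrCA -expRD; congr (_ * expR _); by rewrite /l; field.
apply: le_trans _ (mean_cosh l (expR_ge0 (- (l * t)))).
have l0 : 0 <= l by rewrite divr_ge0 // mulr_ge0 // ltW.
apply: (mean_le (D := setT)) => //; last 2 first.
- exact: probability_setT.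
- move=> w _; rewrite addr0 indicE.
  case: (boolP (w \in A)) => [|_]; last first.
    by rewrite mulr_ge0 ?expR_ge0 // addr_ge0 ?expR_ge0.
  rewrite inE /A /= => tF.
  have lF : l * t <= l * `|F w - m| by rewrite ler_wpM2l.
  rewrite mulrDr -!expRD.
  (* The sign of the deviation decides which of the two exponentials is at least 1. *)
  have [p|p] := leP 0 (F w - m).
    rewrite ger0_norm // in lF.
    have : 1 <= expR (- (l * t) + l * (F w - m)) by rewrite -expR0 ler_expR; lra.
    by have := expR_ge0 (- (l * t) + - l * (F w - m)); lra.
  rewrite ltr0_norm // in lF.
  have : 1 <= expR (- (l * t) + - l * (F w - m)) by rewrite -expR0 ler_expR; lra.
  by have := expR_ge0 (- (l * t) + l * (F w - m)); lra.
Qed.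

End Subgaussian.

(** * Concentration of the empirical distribution function *)

Theorem theorem1p1 (R : realType) :
  exists kappa : R, 0 < kappa /\
  forall (n : nat), (2 <= n)%N ->
  forall (M N : 'M[R[i]]_n), M \is hermsymmx -> N \is hermsymmx ->
  forall (mu : probability (matT R n) R), haar mu ->
  forall x : R,
    let P := (mu \x mu)%E in
    (* F_H(x) for H = U M U^* + V N V^*, (U, V) ~ mu (x) mu *)
    let F := fun w : matT R n * matT R n =>
      edf (w.1 *m M *m adjmx w.1 + w.2 *m N *m adjmx w.2) x in
    let EF := (\int[P]_w (F w)%:E)%E in
    ((\int[P]_w (((F w)%:E - EF) ^+ 2)%E <=
        (kappa * ln n%:R / n%:R)%:E)%E) /\
    (forall t : R, 0 <= t ->
      (P [set w | (t%:E <= `| (F w)%:E - EF |)%E] <=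
        (2 * expR (- (n%:R * t ^+ 2) / (2 * kappa * ln n%:R)))%:E)%E).
Proof.
have ln2 : 0 < ln (2 : R) by rewrite ln_gt0 // ltr1n.
(* The variance bound is $8 e s = 256 e/n$ with $s = 32/n$. Dividing by $\log 2$ leaves the factor
   $q = \log n/\log 2$, which is at least 1 since $n \ge 2$. *)
exists (256 * expR 1 / ln 2); split.
  by apply: divr_gt0 ln2; apply: mulr_gt0 (expR_gt0 1); rewrite ltr0n.
move=> n n2 M N hM hN mu hmu x P F EF.
have n0 : 0 < n%:R :> R by rewrite ltr0n (leq_trans _ n2).
have lnn : ln (2 : R) <= ln n%:R by rewrite ler_ln ?posrE // ler_nat.
pose q := ln n%:R / ln (2 : R).
have q1 : 1 <= q by rewrite ler_pdivlMr // mul1r.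
have hH w : w.1 *m M *m adjmx w.1 + w.2 *m N *m adjmx w.2 \is hermsymmx.
  by apply: hermD; exact: herm_conj.
have bF : bmeas F.
  split.
    apply: edf_measurable; last exact: hH.
    have mc (p : matT R n * matT R n -> matT R n) (A : 'M[R[i]]_n) :
        measurable_fun setT p -> mmeas (fun w => p w *m A *m adjmx (p w)).
      move=> /mmeasP mp; apply: mmeasM; last exact: mmeas_adj.
      by apply: mmeasM => //; exact: mmeas_cst.
    by apply: mmeasD; apply: mc; [exact: measurable_fst|exact: measurable_snd].
  by exists 1 => w; rewrite ger0_norm; [exact: edf_le1 (hH w) | exact: edf_ge0].
(* A perturbation of [U] or [V] of rank at most 1 changes $H$ by rank at most 2. *)
pose c : R := 2 / n%:R.
have Fc (U U' V V' : 'M[R[i]]_n) :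
    (\rank (U - U')%R <= 1)%N -> (\rank (V - V')%R <= 1)%N ->
    F (U, V) - F (U', V) <= c /\ F (U, V) - F (U, V') <= c.
  move=> rU rV; split; apply: le_trans (ler_norm _) _;
    apply: edf_rank (hH (_, _)) (hH (_, _)) _ => /=.
    by rewrite opprD addrACA subrr addr0 rank_conj_sub.
  by rewrite opprD addrACA subrr add0r rank_conj_sub.
(* The value of $8 n c^2$. *)
pose s : R := 32 / n%:R.
have s0 : 0 < s by rewrite divr_gt0.
have mgf l : \int[P]_w expR (l * F w) <= expR (s * l ^+ 2 + l * \int[P]_w F w).
  apply: le_trans (haar_prod_mgf l hmu bF Fc) _.
  rewrite ler_expR le_eqVlt; apply/orP; left; apply/eqP; congr (_ + _).
  by rewrite /s /c; field; rewrite gt_eqF.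
have EFE : EF = (\int[P]_w F w)%:E by exact: integral_mean.
rewrite EFE; split.
  have bV : bmeas (fun w => (F w - \int[P]_w F w) ^+ 2).
    apply: bmeas_sqr; have := bmeas_affine 1 (- (\int[P]_w F w)) bF.
    by under eq_fun do rewrite mul1r.
  rewrite (_ : (\int[P]_w _)%E = (\int[P]_w (F w - \int[P]_w F w) ^+ 2)%R%:E).
    rewrite lee_fin; apply: le_trans (subgaussian_variance bF s0 mgf) _.
    rewrite (_ : _ / n%:R = 8 * expR 1 * s * q).
      by rewrite ler_peMr // mulr_ge0 ?ltW // mulr_gt0 // expR_gt0.
    by rewrite /s /q; field; rewrite !gt_eqF.
  rewrite -(integral_mean P bV); apply: eq_integral => w _.
  by rewrite -EFinB -EFin_expe.
move=> t t0.
rewrite (_ : [set w | _] = [set w | t <= `|F w - \int[P]_w F w|]).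
  apply: le_trans (subgaussian_tail bF s0 mgf t0) _.
  rewrite lee_fin ler_pM2l // ler_expR.
  (* The denominators to compare are 128 and $512 e q$, for which $e \ge 2$ and $q \ge 1$ are
     enough. *)
  have e1 : 2 <= expR (1 : R) by apply: le_trans (expR_ge1Dx 1); lra.
  have -> : 2 * (256 * expR 1 / ln 2) * ln n%:R = 512 * expR 1 * q.
    by rewrite /q; field; rewrite gt_eqF.
  have -> : - t ^+ 2 / (4 * s) = - (n%:R * t ^+ 2) / 128.
    by rewrite /s; field; rewrite gt_eqF.
  rewrite !mulNr lerN2 ler_wpM2l //; first by rewrite mulr_ge0 ?sqr_ge0 // ltW.
  by rewrite lef_pV2 ?posrE; nra.
by apply/seteqP; split => w /=; rewrite lee_fin.
Qed.
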